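(* In the ring $\mathbb{M}_2(\mathbb{Z})$, the matrix $A=\begin{bmatrix} 5 & 5\\ 7 & 7\end{bmatrix}$ is exchange and has stable range 1, but is not clean.
   Context: $\mathbb{M}_2(\mathbb{Z})$ is the ring of $2\times 2$ integer matrices. Let $S$ be a unital ring with group of units $U(S)$. An element $a\in S$ is (left) exchange if there exists $m\in S$ such that $a+m(a-a^{2})$ is idempotent. An element of $S$ is clean if it is the sum of an idempotent and a unit of $S$. An element $a\in S$ has left stable range 1 if whenever $Sa+Sb=S$ for some $b\in S$, there is $y\in S$ with $a+yb\in U(S)$; it has right stable range 1 if whenever $aS+bS=S$ for some $b\in S$, there is $y\in S$ with $a+by\in U(S)$; it has stable range 1 if it has both left and right stable range 1. *)

(* Defs.v *)
From HB Require Import structures.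
From mathcomp Require Import all_boot all_order all_algebra.

Set Implicit Arguments.
Unset Strict Implicit.
Unset Printing Implicit Defensive.

Import GRing.Theory.
Local Open Scope ring_scope.

Definition idempotent_elt (S : unitRingType) (e : S) : Prop := e * e = e.

(* Only the left version: the multiplier m acts on the left of a - a^2. *)
Definition exchange (S : unitRingType) (a : S) : Prop :=
  exists m : S, idempotent_elt (a + m * (a - a ^+ 2)).

Definition clean (S : unitRingType) (a : S) : Prop :=
  exists e u : S, [/\ idempotent_elt e, u \is a GRing.unit & a = e + u].

(* S a + S b = S, where S a = {x a : x in S} *)
Definition left_comaximal (S : unitRingType) (a b : S) : Prop :=
  forall s : S, exists x y : S, s = x * a + y * b.

(* a S + b S = S, where a S = {a x : x in S} *)
Definition right_comaximal (S : unitRingType) (a b : S) : Prop :=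
  forall s : S, exists x y : S, s = a * x + b * y.

Definition left_stable_range1 (S : unitRingType) (a : S) : Prop :=
  forall b : S, left_comaximal a b ->
    exists y : S, a + y * b \is a GRing.unit.

Definition right_stable_range1 (S : unitRingType) (a : S) : Prop :=
  forall b : S, right_comaximal a b ->
    exists y : S, a + b * y \is a GRing.unit.

Definition stable_range1 (S : unitRingType) (a : S) : Prop :=
  left_stable_range1 a /\ right_stable_range1 a.

(* The rows of A are the constant rows (5 5) and (7 7). *)
Definition A : 'M[int]_2 := \matrix_(i < 2, j < 2) (if i == 0 then 5 else 7).

(* Main.v *)
Require Import Defs.
From HB Require Import structures.
From mathcomp Require Import all_boot all_order all_algebra.
From mathcomp Require Import zify ring.

Set Implicit Arguments.
Unset Strict Implicit.
Unset Printing Implicit Defensive.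

Import GRing.Theory.
Local Open Scope ring_scope.

(** The matrix A is the column (5, 7) times the row (1, 1), so A ^ 2 = 12 A.

    Exchange.  A + M (A - A ^ 2) = (1 - 11 M) A is the column
    w = (1 - 11 M) (5, 7) times the row (1, 1), which is idempotent as soon as
    the entries of w add up to 1; any column congruent to (5, 7) modulo 11 can
    be reached, and w = (5, -4) will do.

    Stable range 1.  The row (1, 1) and the column (5, 7) are unimodular, so A
    is equivalent to diag(1, 0) and hence is a unit times an idempotent
    ([A_unit_factorization]).  In every ring such an element has stable
    range 1 ([unit_mul_idempotent_stable_range1]): the complementary idempotent
    turns a comaximality relation into a unipotent element.

    Not clean.  Let E be an idempotent with det (A - E) = 1 or -1.  Since
    det (A - 0) = 0 and det (A - 1) = -11, E has trace 1 and determinant 0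
    ([idempotent_mx2_cases]), and then det (A - E) = tr (A E) - 12, so that
    p = tr (A E) is 11 or 13.  Both are prime, while the column E (5, 7) times
    the row (1, 1) E equals E A E = p E.  Hence p divides the column or the row
    ([prime_dvd_outer_product]), and dividing it out writes E as a column
    (x, y) times a row (u, v), where x + y = 1 or 5 u + 7 v = 1.  For such an E,
    det (A - E) = (7 x - 5 y) (v - u), so both factors are 1 or -1, and one of
    the two normalizations then fails modulo 12 ([no_unit_rank_one]). *)

(** * Stable range 1 for a unit times an idempotent *)

Lemma unipotent_unit (S : unitRingType) (n : S) :
  n * n = 0 -> 1 + n \is a GRing.unit.
Proof.
move=> nn0; apply/unitrP; exists (1 - n).
by rewrite mulrBl mulrDl !mul1r mulrDr mulrBr !mulr1 nn0 addr0 subr0 addrK subrK.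
Qed.

Section IdempotentStableRange.

Variables (S : unitRingType) (e : S).
Hypothesis ee : idempotent_elt e.

Let ef0 : e * (1 - e) = 0. Proof. by rewrite mulrBr mulr1 ee subrr. Qed.
Let fe0 : (1 - e) * e = 0. Proof. by rewrite mulrBl mul1r ee subrr. Qed.
Let ff : (1 - e) * (1 - e) = 1 - e.
Proof. by rewrite mulrBr mulr1 fe0 subr0. Qed.
Let splitr t : t * e + t * (1 - e) = t.
Proof. by rewrite -mulrDr addrC subrK mulr1. Qed.
Let splitl t : e * t + (1 - e) * t = t.
Proof. by rewrite -mulrDl addrC subrK mul1r. Qed.

(** Multiplying the relation by f = 1 - e on the right gives y b f = f, hence
    e + f y b = 1 + f y b e, and f y b e has square zero because e f = 0. *)
Lemma idempotent_left_unit (x y b : S) :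
  x * e + y * b = 1 -> e + (1 - e) * y * b \is a GRing.unit.
Proof.
move=> xyb1.
have ybf : y * b * (1 - e) = 1 - e.
  have := congr1 (fun t => t * (1 - e)) xyb1.
  by rewrite mul1r mulrDl -(mulrA x) ef0 mulr0 add0r.
have -> : e + (1 - e) * y * b = 1 + (1 - e) * (y * b) * e.
  rewrite -[(1 - e) * y * b]splitr -!mulrA (mulrA y) ybf ff.
  by rewrite addrCA addrC (addrC e) subrK.
apply: unipotent_unit.
by rewrite !mulrA -(mulrA _ e (1 - e)) ef0 mulr0 !mul0r.
Qed.

(** The mirror image: here f b y = f, so that e + b y f = 1 + e b y f. *)
Lemma idempotent_right_unit (x y b : S) :
  e * x + b * y = 1 -> e + b * (y * (1 - e)) \is a GRing.unit.
Proof.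
move=> xyb1.
have fby : (1 - e) * (b * y) = 1 - e.
  have := congr1 (fun t => (1 - e) * t) xyb1.
  by rewrite mulr1 mulrDr (mulrA _ e) fe0 mul0r add0r.
have -> : e + b * (y * (1 - e)) = 1 + e * (b * y) * (1 - e).
  rewrite -[b * (y * (1 - e))]splitl !mulrA -(mulrA (1 - e) b) fby ff.
  by rewrite addrCA addrC (addrC e) subrK.
apply: unipotent_unit.
by rewrite !mulrA -(mulrA _ (1 - e) e) fe0 mulr0 !mul0r.
Qed.

(** The unit is transported to the other summand: on the left by multiplying
    the conclusion by u, on the right by conjugating the relation by u. *)
Lemma unit_mul_idempotent_stable_range1 (u : S) :
  u \is a GRing.unit -> stable_range1 (u * e).
Proof.
move=> uU; split=> b /(_ 1) [x [y xyb1]].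
- exists (u * ((1 - e) * y)).
  rewrite -mulrA -mulrDr unitrMr //.
  by apply: (@idempotent_left_unit (x * u)); rewrite -mulrA.
- exists (y * u * (1 - e)).
  have -> : u * e + b * (y * u * (1 - e))
      = u * (e + u^-1 * b * (y * u * (1 - e))).
    by rewrite [RHS]mulrDr -!mulrA mulVKr.
  rewrite unitrMr //; apply: (@idempotent_right_unit (x * u)).
  have -> : e * (x * u) + u^-1 * b * (y * u) = u^-1 * (u * e * x + b * y) * u.
    by rewrite mulrDr mulrDl -!mulrA mulKr.
  by rewrite -xyb1 mulr1 mulVr.
Qed.

End IdempotentStableRange.

(** * Two by two matrices *)

Section Matrix2.

Variable R : comUnitRingType.
Implicit Types M N : 'M[R]_2.

Lemma sum_ord2 (F : 'I_2 -> R) : \sum_i F i = F 0 + F 1.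
Proof.
by rewrite big_ord_recl big_ord1; congr (_ + F _); apply: val_inj.
Qed.

Lemma mul_mx2E M N i j : (M * N) i j = M i 0 * N 0 j + M i 1 * N 1 j.
Proof. by rewrite mxE sum_ord2. Qed.

Lemma det_mx2E M : \det M = M 0 0 * M 1 1 - M 0 1 * M 1 0.
Proof.
rewrite (expand_det_row _ 0) sum_ord2 /cofactor !det_mx11 !mxE /=.
rewrite expr0 mul1r expr1 mulN1r mulrN.
by congr (_ * M _ _ - _ * M _ _); apply: val_inj.
Qed.

Definition mx2 (a b c d : R) : 'M[R]_2 :=
  \matrix_(i, j) if i == 0 then if j == 0 then a else b
                 else if j == 0 then c else d.

Lemma eq_mx2 M N :
    M 0 0 = N 0 0 -> M 0 1 = N 0 1 -> M 1 0 = N 1 0 -> M 1 1 = N 1 1 -> M = N.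
Proof.
move=> e00 e01 e10 e11; apply/matrixP.
have ord2 (i : 'I_2) : i = 0 \/ i = 1.
  by case: i => [[|[|//]] lt_i]; [left | right]; apply: val_inj.
by move=> i j; case: (ord2 i) => ->; case: (ord2 j) => ->.
Qed.

Lemma mul_mx2 a b c d a' b' c' d' :
  mx2 a b c d * mx2 a' b' c' d' =
  mx2 (a * a' + b * c') (a * b' + b * d') (c * a' + d * c') (c * b' + d * d').
Proof. by apply: eq_mx2; rewrite mul_mx2E !mxE. Qed.

End Matrix2.

Lemma unit_mx2_int (M : 'M[int]_2) :
  M \is a GRing.unit <->
  M 0 0 * M 1 1 - M 0 1 * M 1 0 = 1 \/ M 0 0 * M 1 1 - M 0 1 * M 1 0 = -1.
Proof.
have -> : (M \is a GRing.unit) = (\det M \is a GRing.unit) := unitmxE M.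
rewrite det_mx2E; split; first by case/orP => /eqP ->; [left | right].
by case=> ->.
Qed.

Lemma A_mx2 : A = mx2 5 5 7 7.
Proof. by apply: eq_mx2; rewrite !mxE. Qed.

(** * The two positive statements *)

Lemma A_exchange : exchange (A : 'M[int]_2).
Proof.
(* This M sends the column (5, 7) to (0, 1), so that w = (5, -4). *)
exists (mx2 0 0 3 (-2)).
have -> : A + mx2 0 0 3 (-2) * (A - A ^+ 2) = mx2 5 5 (-4) (-4).
  rewrite expr2 A_mx2 mul_mx2.
  by apply: eq_mx2; rewrite mxE mul_mx2E !mxE.
by rewrite /idempotent_elt mul_mx2.
Qed.

(** The unit is the inverse of V = (1, -1; 2, -1), a unimodular matrix with
    (1, 1) V (5, 7)^T = 1.  Hence A V A = A and the second factor V A is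
    idempotent. *)
Lemma A_unit_factorization :
  A = mx2 (-1) 1 (-2) 1 * mx2 (-2) (-2) 3 3 :> 'M[int]_2.
Proof. by rewrite A_mx2 mul_mx2. Qed.

Lemma A_stable_range1 : stable_range1 (A : 'M[int]_2).
Proof.
rewrite A_unit_factorization; apply: unit_mul_idempotent_stable_range1.
  by rewrite /idempotent_elt mul_mx2.
by apply/unit_mx2_int; rewrite !mxE; left.
Qed.

(** * The matrix is not clean *)

(** Off-diagonal entries are killed by trace - 1; if they vanish and the trace
    is not 1, the diagonal entries are both 0 or both 1. *)
Lemma idempotent_mx2_cases (a b c d : int) :
    a * a + b * c = a -> a * b + b * d = b ->
    c * a + d * c = c -> c * b + d * d = d ->
  [\/ [/\ a = 0, b = 0, c = 0 & d = 0], [/\ a = 1, b = 0, c = 0 & d = 1]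
    | a + d = 1 /\ a * d = b * c].
Proof.
move=> eq00 eq01 eq10 eq11.
have [tr1 | trN1] := eqVneq (a + d) 1.
  have dE : d = 1 - a by lia.
  by constructor 3; split => //; rewrite dE; lia.
have trB : a + d - 1 != 0 by rewrite subr_eq0.
have zero_of (t : int) : t * (a + d - 1) = 0 -> t = 0.
  by move/eqP; rewrite mulf_eq0 (negPf trB) orbF => /eqP.
have b0 : b = 0 by apply: zero_of; lia.
have c0 : c = 0 by apply: zero_of; lia.
have idem (t : int) : t * t = t -> t = 0 \/ t = 1.
  move=> tt; have /eqP : t * (t - 1) = 0 by lia.
  by rewrite mulf_eq0 subr_eq0 => /orP [] /eqP; [left | right].
rewrite b0 c0 in eq00 eq11 *.
have ad : (a = 0 \/ a = 1) /\ (d = 0 \/ d = 1).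
  by split; apply: idem; lia.
case: ad => -[a0|a1] [d0|d1]; try by lia.
- by constructor 1.
- by constructor 2.
Qed.

Lemma Euclid_dvdzM (p : nat) (m n : int) :
  prime p -> (p %| m * n)%Z = (p %| m)%Z || (p %| n)%Z.
Proof. by move=> p_pr; rewrite !dvdzE abszM Euclid_dvdM. Qed.

(** If p misses some entry of one vector, it divides every entry of the
    other. *)
Lemma prime_dvd_outer_product (p : nat) (w1 w2 r1 r2 : int) :
    prime p -> (p %| w1 * r1)%Z -> (p %| w1 * r2)%Z ->
    (p %| w2 * r1)%Z -> (p %| w2 * r2)%Z ->
  (p %| w1)%Z && (p %| w2)%Z \/ (p %| r1)%Z && (p %| r2)%Z.
Proof.
move=> p_pr; rewrite !Euclid_dvdzM //.
by case: (p %| w1)%Z; case: (p %| w2)%Z => /= *; by [left | right; apply/andP].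
Qed.

Lemma int_mul_eq_unit (m n : int) :
    m * n = 1 \/ m * n = -1 -> (m = 1 \/ m = -1) /\ (n = 1 \/ n = -1).
Proof.
move=> mn1.
have /andP [mU nU] : (m \is a GRing.unit) && (n \is a GRing.unit).
  by rewrite -unitrM; case: mn1 => ->.
by split; [case/orP: mU | case/orP: nU] => /eqP ->; [left|right|left|right].
Qed.

(** For E the column (x, y) times the row (u, v), of trace x u + y v = 1,
    det (A - E) = (x + y) (5 u + 7 v) - 12, which factors as
    (7 x - 5 y) (v - u).  If x + y = 1 then
    7 x - 5 y = 7 - 12 y, and if 5 u + 7 v = 1 then 7 (v - u) = 1 - 12 u; neither
    is compatible with a factor 1 or -1. *)
Lemma no_unit_rank_one (x y u v : int) :
    x * u + y * v = 1 -> x + y = 1 \/ 5 * u + 7 * v = 1 ->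
  ~ ((x + y) * (5 * u + 7 * v) - 12 = 1 \/
     (x + y) * (5 * u + 7 * v) - 12 = -1).
Proof.
move=> dot1 norm.
have -> : (x + y) * (5 * u + 7 * v) - 12 = (7 * x - 5 * y) * (v - u).
  by rewrite -[X in _ - X]mulr1 -dot1; ring.
by move/int_mul_eq_unit => [hxy huv]; case: norm => ?; lia.
Qed.

(** With w = E (5, 7) and r = (1, 1) E, one has w r = E A E = tr (A E) E, and
    the trace of A E is both r (5, 7) and (1, 1) w. *)
Lemma no_unit_trace_one (a b c d : int) :
    a + d = 1 -> a * d = b * c ->
  ~ ((5 - a) * (7 - d) - (5 - b) * (7 - c) = 1 \/
     (5 - a) * (7 - d) - (5 - b) * (7 - c) = -1).
Proof.
move=> tr1 det0.
pose t := 5 * (a + c) + 7 * (b + d).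
have -> : (5 - a) * (7 - d) - (5 - b) * (7 - c) = t - 12 by rewrite /t; lia.
move=> t12.
(* The neighbours of 12 = tr A are both prime. *)
have [p p_pr tp] : exists2 p : nat, prime p & t = p%:Z.
  by case: t12 => t12; [exists 13%N | exists 11%N] => //; lia.
have p_neq0 : p%:Z != 0 by rewrite eqz_nat -lt0n prime_gt0.
have cancel_p m n : m * p%:Z = n * p%:Z -> m = n by apply: mulIf.
have dE : d = 1 - a by lia.
rewrite dE in det0.
pose w1 := 5 * a + 7 * b; pose w2 := 5 * c + 7 * d.
pose r1 := a + c; pose r2 := b + d.
have wt : w1 + w2 = t by rewrite /w1 /w2 /t; ring.
have rt : 5 * r1 + 7 * r2 = t by [].
have wr11 : w1 * r1 = a * p by rewrite -tp /w1 /r1 /t dE; lia.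
have wr12 : w1 * r2 = b * p by rewrite -tp /w1 /r2 /t dE; lia.
have wr21 : w2 * r1 = c * p by rewrite -tp /w2 /r1 /t dE; lia.
have wr22 : w2 * r2 = d * p by rewrite -tp /w2 /r2 /t dE; lia.
have [] := @prime_dvd_outer_product p w1 w2 r1 r2 p_pr;
  rewrite ?wr11 ?wr12 ?wr21 ?wr22 ?dvdz_mull //.
- case/andP=> /dvdzP [x w1E] /dvdzP [y w2E].
  have xy1 : x + y = 1 by apply: cancel_p; rewrite mulrDl -w1E -w2E wt tp mul1r.
  apply: (@no_unit_rank_one x y r1 r2); last by rewrite xy1 mul1r rt.
    apply: cancel_p.
    by rewrite mulrDl mulrAC -w1E wr11 mulrAC -w2E wr22 -mulrDl tr1.
  by left.
- case/andP=> /dvdzP [u r1E] /dvdzP [v r2E].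
  have uv1 : 5 * u + 7 * v = 1.
    by apply: cancel_p; rewrite mulrDl -!mulrA -r1E -r2E rt tp mul1r.
  apply: (@no_unit_rank_one w1 w2 u v); last by rewrite uv1 mulr1 wt.
    apply: cancel_p.
    by rewrite mulrDl -!mulrA -r1E -r2E wr11 wr22 -mulrDl tr1.
  by right.
Qed.

Theorem mainTheorem6 : exchange (A : 'M[int]_2) /\ stable_range1 A /\ ~ clean A.
Proof.
split; first exact: A_exchange.
split; first exact: A_stable_range1.
case=> E [U [EE UU AE]].
have {UU AE} : A - E \is a GRing.unit by rewrite AE addrC addKr.
move/unit_mx2_int; rewrite A_mx2 !mxE /=.
have entry i j : E i 0 * E 0 j + E i 1 * E 1 j = E i j by rewrite -mul_mx2E EE.
have [] := idempotent_mx2_cases (entry 0 0) (entry 0 1) (entry 1 0) (entry 1 1).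
- by case=> -> -> -> -> [].
- by case=> -> -> -> -> [].
by case=> tr1 det0; apply: no_unit_trace_one.
Qed.
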